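(* For all $k\ge1$, the following hold: $$F_{2k\ldots21}(x)=\frac{U_{k-1}\left(\frac{1-x}{2x}\right)}{x\,U_k\left(\frac{1-x}{2x}\right)}$$ and $$F_{2k-1\ldots21}(x)=\frac{U_{k-1}\left(\frac{1-x}{2x}\right)+U_{k-2}\left(\frac{1-x}{2x}\right)}{x\left(U_k\left(\frac{1-x}{2x}\right)+U_{k-1}\left(\frac{1-x}{2x}\right)\right)}.$$
   Context: For a permutation $\sigma$ (in one-line notation), $I_n(3412,\sigma)$ is the set of involutions of $\{1,\ldots,n\}$ which avoid both $3412$ and $\sigma$ (no subsequence has the same relative order as the pattern), and $F_\sigma(x)=\sum_{n\ge0}|I_n(3412,\sigma)|x^n$. The pattern $m\ldots21$ is the decreasing permutation of length $m$. $U_n(x)$ is the $n$th Chebyshev polynomial of the second kind: $U_{-1}(x)=0$ and $U_n(\cos t)=\frac{\sin((n+1)t)}{\sin t}$ for $n\ge0$. *)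

(* Defs.v *)
From HB Require Import structures.
From mathcomp Require Export all_boot all_order all_algebra.
From mathcomp Require Export perm.
From mathcomp Require Export mathcomp_extra boolp classical_sets reals.
From mathcomp Require Export topology normedtype sequences realfun trigo.
From mathcomp Require Import lra ring.

Set Implicit Arguments.
Unset Strict Implicit.
Unset Printing Implicit Defensive.

Import Order.TTheory GRing.Theory Num.Theory.

Local Open Scope ring_scope.

(* A pattern is a permutation in one-line notation, e.g. [:: 3; 4; 1; 2];
   the map f selects the positions of an order-isomorphic subsequence of p. *)
Definition contains (n : nat) (s : seq nat) (p : 'S_n) : bool :=
  [exists f : {ffun 'I_(size s) -> 'I_n},
     [forall i : 'I_(size s), forall j : 'I_(size s), (i < j)%N ==> (f i < f j)%N] &&
     [forall i : 'I_(size s), forall j : 'I_(size s),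
        (nth 0%N s i < nth 0%N s j)%N == (p (f i) < p (f j))%N]].

Definition avoids (n : nat) (s : seq nat) (p : 'S_n) : bool := ~~ contains s p.

(* As for pattern-avoiding involutions in general, the identity counts as an
   involution. *)
Definition involutions_avoiding (n : nat) (s t : seq nat) : {set 'S_n} :=
  [set p : 'S_n | [forall i, p (p i) == i] && avoids s p && avoids t p].

Definition decreasing_pattern (m : nat) : seq nat := rev (iota 1 m).

(* Formal power series are given by their coefficient sequences. *)
Definition gen_fun (R : realType) (s : seq nat) : nat -> R :=
  fun n => #|involutions_avoiding n [:: 3; 4; 1; 2]%N s|%:R.

(* The rational function r, an element of the field of fractions R(x), is
   regular at 0 and its power series expansion at 0 is sum_n a_n x^n: writing
   r = p / q with q(0) <> 0, the Cauchy product of q and a is p. *)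
Definition expands_to (R : realType) (r : {fraction {poly R}}) (a : nat -> R) :
    Prop :=
  exists p q : {poly R},
    [/\ q`_0 != 0,
        r = FracField.tofrac p / FracField.tofrac q &
        forall n, \sum_(i < n.+1) q`_i * a (n - i)%N = p`_n].

Definition fracX (R : realType) : {fraction {poly R}} := FracField.tofrac 'X.

(* Where sin t = 0 the quotient is undefined (0 in the library). *)
Definition is_chebyshevU (R : realType) (n : nat) (p : {poly R}) : Prop :=
  forall t : R, sin t != 0 -> p.[cos t] = sin (n.+1%:R * t) / sin t.

(* U_n for n >= -1 (the value at n < -1 is not used); U_n for n >= 0 is well
   defined by chebyshevUP and is_chebyshevU_unique. *)
Definition chebyshevU (R : realType) (n : int) : {poly R} :=
  match n with
  | Posz m => xget 0 (fun p : {poly R} => is_chebyshevU m p)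
  | Negz _ => 0
  end.

Definition eval_frac (R : realType) (p : {poly R}) (y : {fraction {poly R}}) :
    {fraction {poly R}} :=
  (map_poly (fun c : R => FracField.tofrac c%:P) p).[y].

Lemma is_chebyshevU_exists (R : realType) (n : nat) :
  exists p : {poly R}, is_chebyshevU n p.
Proof.
suff [p [q [Hp _]]] : exists p q : {poly R},
  is_chebyshevU n p /\ is_chebyshevU n.+1 q by exists p.
elim: n => [|n [p [q [Hp Hq]]]].
  exists 1, ('X *+ 2); split=> t st.
    by rewrite hornerE mul1r divff.
  by rewrite hornerMn hornerX mulr_natl sin_mulr2n -mulrnAl mulfK.
exists q, ('X *+ 2 * q - p); split=> // t st.
rewrite hornerD hornerN hornerM hornerMn hornerX Hp // Hq //.
have e1 : n.+3%:R * t = n.+2%:R * t + t :> R.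
  by rewrite -(natr1 n.+2) mulrDl mul1r.
have e2 : n.+1%:R * t = n.+2%:R * t - t :> R.
  by rewrite -(natr1 n.+1) mulrDl mul1r addrK.
by rewrite e1 e2 !sinD sinN cosN; field.
Qed.

Lemma is_chebyshevU_unique (R : realType) (n : nat) (p q : {poly R}) :
  is_chebyshevU n p -> is_chebyshevU n q -> p = q.
Proof.
move=> Hp Hq; apply/eqP; rewrite -subr_eq0; apply/negPn/negP => nz.
pose g (i : nat) : R := i.+2%:R^-1.
have ginj : injective g.
  by move=> i j /invr_inj /eqP; rewrite eqr_nat => /eqP [].
have := max_poly_roots nz (rs := map g (iota 0 (size (p - q)))).
rewrite size_map size_iota ltnn map_inj_uniq // iota_uniq => H.
suff /H/(_ isT) : all (root (p - q)) [seq g i | i <- iota 0 (size (p - q))] by [].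
apply/allP => _ /mapP[i _ ->].
have g0 : 0 < g i by rewrite invr_gt0 ltr0n.
have g1 : g i < 1 by rewrite invf_lt1 ?ltr0n // ltr1n.
have gI : -1 <= g i <= 1 by apply/andP; split; lra.
have ce : cos (acos (g i)) = g i by rewrite acosK // in_itv.
have se : sin (acos (g i)) != 0.
  rewrite sin_acos // gt_eqF // sqrtr_gt0; nra.
by apply/rootP; rewrite hornerD hornerN -ce Hp // Hq // subrr.
Qed.

Lemma chebyshevUP (R : realType) (n : nat) :
  is_chebyshevU n (chebyshevU R n%:Z).
Proof. exact: (xgetPex 0 (is_chebyshevU_exists R n)). Qed.

(* Main.v *)
Require Import Defs.
From mathcomp Require Import zify ring.

(** An involution avoids 3412 exactly when it is noncrossing: no two of its
    arcs [{i, p i}] cross ([avoids_3412_noncrossing]).  Such an involution of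
    size n + 1 either fixes its least point, or matches it with some j + 1, and
    then it consists of an arbitrary noncrossing involution q under this arc
    followed by an arbitrary noncrossing involution r after it
    ([noncrossing_word_decomp]).  A decreasing subsequence lies either in the
    block formed by the arc and q or in r, and in the former case the two ends of
    the arc may be added to any decreasing subsequence of q.  So p has no
    decreasing subsequence of length m + 2 if and only if q has none of length m
    and r has none of length m + 2 ([decreasing_lt_arc]).  Hence
      F_(m+2) = 1 + x F_(m+2) + x^2 F_m F_(m+2),
    that is F_(m+2) = 1/(1 - x - x^2 F_m), where F_m is the generating function
    for the pattern m...21 ([avoider_count_rec]).

    Let Q_k be a sequence of polynomials with
    Q_(k+2) = (1 - x) Q_(k+1) - x^2 Q_k.  If F_m = Q_0/Q_1, then induction gives
    F_(m+2k) = Q_k/Q_(k+1) ([trunc_gf_ladder]; power series are handled as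
    polynomials modulo x^N).  The polynomials P_k = x^(k-1) U_(k-1)((1-x)/(2x))
    satisfy this recurrence, because U_(k+1)(y) = 2y U_k(y) - U_(k-1)(y)
    ([eval_chebyshevU]).  Starting from F_0 = 0 = P_0/P_1 one gets the even
    lengths.  Starting from F_1 = 1 with Q_k = P_(k+1) + x P_k, for which
    Q_0 = Q_1 = 1, one gets the odd lengths. *)

Set Implicit Arguments.
Unset Strict Implicit.
Unset Printing Implicit Defensive.
Import Order.TTheory GRing.Theory Num.Theory.
Local Open Scope ring_scope.

(** * Noncrossing involutions *)

(** [f] restricts to an involution of the interval [[a, a + l)] no two of whose
    arcs [{i, f i}] cross; intervals are general because the arc through the
    least point splits an interval into two smaller ones. *)
Definition noncrossing_on (f : nat -> nat) (a l : nat) : Prop :=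
  forall i, (a <= i < a + l)%N ->
    [/\ (a <= f i < a + l)%N, f (f i) = i &
        forall j, (i < j < f i)%N -> (f j < f i)%N].

Lemma noncrossing_on_shift (f g : nat -> nat) (a l : nat) :
  (forall i, (i < l)%N -> f (a + i)%N = (a + g i)%N) ->
  noncrossing_on f a l <-> noncrossing_on g 0 l.
Proof.
move=> fg; split=> H i hi.
- have [] := H (a + i)%N ltac:(lia); rewrite fg; last lia.
  move=> h1 h2 h3; split; first lia.
    by move: h2; rewrite fg; lia.
  by move=> j hj; have := h3 (a + j)%N ltac:(lia); rewrite fg; lia.
- have [k kl ->] : exists2 k, (k < l)%N & i = (a + k)%N.
    by exists (i - a)%N; lia.
  have [] := H k ltac:(lia); rewrite fg // => h1 h2 h3; split; first lia.
    by rewrite fg; lia.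
  move=> j hj; have := h3 (j - a)%N ltac:(lia).
  have -> : f j = (a + g (j - a))%N by rewrite -fg; [congr f|]; lia.
  lia.
Qed.

Lemma noncrossing_on_fixed (f : nat -> nat) (n : nat) : f 0%N = 0%N ->
  noncrossing_on f 0 n.+1 <-> noncrossing_on f 1 n.
Proof.
move=> f0; split=> H i hi.
- have [h1 h2 h3] := H i ltac:(lia); split=> //.
  have : f i <> 0%N by move=> e; move: h2; rewrite e f0; lia.
  lia.
- case: (posnP i) => [->|ip].
    by rewrite !f0; split=> //; lia.
  by have [h1 h2 h3] := H i ltac:(lia); split=> //; lia.
Qed.

(** The arc [{0, j + 1}] separates the points it covers from those beyond it: a
    point under the arc has its partner under the arc by the noncrossing
    condition, so the points beyond are matched among themselves. *)
Lemma noncrossing_on_arc (f : nat -> nat) (n j : nat) :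
  f 0%N = j.+1 ->
  noncrossing_on f 0 n.+1 <->
  [/\ (j < n)%N, f j.+1 = 0%N, noncrossing_on f 1 j &
      noncrossing_on f j.+2 (n - j.+1)].
Proof.
move=> f0; split=> [H|[jn fj Hq Hr] i hi].
- have [b0 i0 c0] := H 0%N ltac:(lia); rewrite f0 in b0 i0 c0.
  have jn : (j < n)%N by lia.
  have inner i : (0 < i < j.+1)%N -> (0 < f i < j.+1)%N.
    move=> hi; have [h1 h2 h3] := H i ltac:(lia).
    have : f i <> 0%N by move=> e; move: h2; rewrite e f0; lia.
    by have := c0 i hi; lia.
  split=> // i hi; have [h1 h2 h3] := H i ltac:(lia); split=> //.
    by have := inner i ltac:(lia); lia.
  have n1 : f i <> 0%N by move=> e; move: h2; rewrite e f0; lia.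
  have n2 : f i <> j.+1 by move=> e; move: h2; rewrite e i0; lia.
  case: (ltnP (f i) j.+1) => hh; last by lia.
  by have := inner (f i) ltac:(lia); rewrite h2; lia.
- have Hq1 k : (0 < k < j.+1)%N -> (0 < f k < j.+1)%N.
    by move=> hk; have [] := Hq k ltac:(lia); lia.
  case: (posnP i) => [->|ip].
    rewrite !f0 fj; split=> //; try lia.
    by move=> k hk; have := Hq1 k; lia.
  case: (ltngtP i j.+1) => hij.
  + by have [h1 h2 h3] := Hq i ltac:(lia); split=> //; lia.
  + by have [h1 h2 h3] := Hr i ltac:(lia); split=> //; lia.
  + by rewrite hij fj f0; split=> //; lia.
Qed.

(** The word of (1 - q - 1) + r, where - and + stand for the skew and the direct
    sum: the general noncrossing involution that moves its least point.  The
    first two blocks are grouped because no decreasing subsequence meets both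
    that group and the last block. *)
Definition arc (q r : seq nat) : seq nat :=
  ((size q).+1 :: map S q ++ [:: 0%N]) ++ map (addn (size q).+2) r.

Lemma size_arc q r : size (arc q r) = (size q + size r).+2.
Proof. rewrite /arc size_cat /= size_cat !size_map /=; lia. Qed.

Lemma nth_arc_inner q r i : (i < size q)%N ->
  nth 0%N (arc q r) (1 + i) = (1 + nth 0%N q i)%N.
Proof.
move=> hi; rewrite /arc nth_cat /= size_cat size_map /=.
rewrite ifT; last lia.
by rewrite nth_cat size_map hi (nth_map 0%N).
Qed.

Lemma nth_arc_close q r : nth 0%N (arc q r) (size q).+1 = 0%N.
Proof.
rewrite /arc nth_cat /= size_cat size_map /= ifT; last lia.
by rewrite nth_cat size_map ltnn subnn.
Qed.

Lemma nth_arc_outer q r i : (i < size r)%N ->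
  nth 0%N (arc q r) ((size q).+2 + i) = ((size q).+2 + nth 0%N r i)%N.
Proof.
move=> hi; rewrite /arc nth_cat /= size_cat size_map /=.
rewrite ifF; last lia.
have -> : ((size q).+2 + i - (size q + 1).+1 = i)%N by lia.
by rewrite (nth_map 0%N).
Qed.

Definition noncrossing_word (w : seq nat) : Prop :=
  noncrossing_on (nth 0%N w) 0 (size w).

Lemma noncrossing_word_fixed (w : seq nat) :
  noncrossing_word (0%N :: map S w) <-> noncrossing_word w.
Proof.
rewrite /noncrossing_word /= size_map noncrossing_on_fixed //.
apply: noncrossing_on_shift => i hi /=.
by rewrite (nth_map 0%N).
Qed.

Lemma noncrossing_word_arc (q r : seq nat) :
  noncrossing_word (arc q r) <-> noncrossing_word q /\ noncrossing_word r.
Proof.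
rewrite /noncrossing_word size_arc (@noncrossing_on_arc _ _ (size q)) //.
have -> : ((size q + size r).+1 - (size q).+1 = size r)%N by lia.
have Eq := noncrossing_on_shift (@nth_arc_inner q r).
have Er := noncrossing_on_shift (@nth_arc_outer q r).
split=> [[_ _ /Eq ? /Er ?] //|[/Eq ? /Er ?]].
by split=> //; [lia|exact: nth_arc_close].
Qed.

(** The shape is read off the image of the least point: it is fixed, or it is
    matched with [j + 1] and the two intervals cut out by this arc carry the
    shifted words [q] and [r]. *)
Lemma noncrossing_word_decomp (w : seq nat) (n : nat) :
  size w = n.+1 -> noncrossing_word w ->
  (exists2 w', size w' = n & w = 0%N :: map S w') \/
  (exists q r, [/\ (size q < n)%N, size r = (n - (size q).+1)%N & w = arc q r]).
Proof.
rewrite /noncrossing_word => sw; rewrite sw => H.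
case E : (nth 0%N w 0) => [|j].
  left; move/(noncrossing_on_fixed n E): H => H.
  exists (mkseq (fun i => (nth 0%N w i.+1).-1) n); first by rewrite size_mkseq.
  apply: (@eq_from_nth _ 0%N); first by rewrite /= size_map size_mkseq.
  case=> [|i] //=; rewrite sw ltnS => hi.
  rewrite (nth_map 0%N) ?size_mkseq // nth_mkseq //.
  by have [] := H i.+1 ltac:(lia); lia.
right; move/(noncrossing_on_arc n E): H => [jn ej Hq Hr].
pose q := mkseq (fun i => (nth 0%N w i.+1).-1) j.
pose r := mkseq (fun i => nth 0%N w (j.+2 + i) - j.+2)%N (n - j.+1).
have sq : size q = j by rewrite size_mkseq.
have sr : size r = (n - j.+1)%N by rewrite size_mkseq.
exists q, r; rewrite sq sr; split=> //.
apply: (@eq_from_nth _ 0%N); first by rewrite size_arc sq sr sw; lia.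
rewrite sw => i hi.
case: (posnP i) => [->|ip]; first by rewrite E /= sq.
case: (ltngtP i j.+1) => hij.
- have -> : i = (1 + i.-1)%N by lia.
  rewrite nth_arc_inner ?sq; last lia.
  rewrite nth_mkseq; last lia.
  by rewrite add1n; have [] := Hq i.-1.+1 ltac:(lia); lia.
- have -> : i = ((size q).+2 + (i - j.+2))%N by rewrite sq; lia.
  rewrite nth_arc_outer ?sr; last lia.
  rewrite nth_mkseq ?sq; last lia.
  by have [] := Hr (j.+2 + (i - j.+2))%N ltac:(lia); lia.
- by rewrite hij -{2}sq nth_arc_close.
Qed.

(** * Decreasing subsequences of words *)

Definition decreasing_lt (m : nat) (w : seq nat) : Prop :=
  forall s, subseq s w -> sorted gtn s -> (size s < m)%N.

Lemma subseq_catP (T : eqType) (s a b : seq T) : subseq s (a ++ b) ->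
  exists s1 s2, [/\ s = s1 ++ s2, subseq s1 a & subseq s2 b].
Proof.
case/subseqP=> k sk ->; rewrite -(cat_take_drop (size a) k) mask_cat.
  by do 2!eexists; split; first reflexivity; exact: mask_subseq.
by rewrite size_takel // sk size_cat leq_addr.
Qed.

Lemma subseq_mapP (S T : eqType) (f : S -> T) s w : subseq s (map f w) ->
  exists2 s', subseq s' w & s = map f s'.
Proof.
case/subseqP=> k sk ->; rewrite -map_mask.
by exists (mask k w) => //; exact: mask_subseq.
Qed.

Lemma sorted_gtn_map_add c s : sorted gtn (map (addn c) s) = sorted gtn s.
Proof. by apply: mono_sorted => x y; rewrite /= ltn_add2l. Qed.

Lemma gtn_trans : transitive gtn.
Proof. by move=> x y z /= ? ?; lia. Qed.

Lemma sorted_gtn_cat s1 s2 : sorted gtn (s1 ++ s2) ->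
  [/\ sorted gtn s1, sorted gtn s2 & allrel gtn s1 s2].
Proof.
by rewrite !(sorted_pairwise gtn_trans) pairwise_cat => /and3P[-> -> ->].
Qed.

Lemma decreasing_lt_subseq m w w' : subseq w' w ->
  decreasing_lt m w -> decreasing_lt m w'.
Proof. by move=> sub H s sw; apply: H; exact: subseq_trans sw sub. Qed.

Lemma decreasing_lt_map_add m c w :
  decreasing_lt m (map (addn c) w) <-> decreasing_lt m w.
Proof.
split=> H s.
- move=> sub so; rewrite -(size_map (addn c)); apply: H.
    exact: map_subseq.
  by rewrite sorted_gtn_map_add.
- case/subseq_mapP=> t sub ->; rewrite sorted_gtn_map_add size_map.
  exact: H.
Qed.

(** A decreasing subsequence cannot take a letter of [a] and then a larger letter
    of [b]. *)
Lemma decreasing_lt_cat m a b : (forall x y, x \in a -> y \in b -> (x < y)%N) ->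
  decreasing_lt m (a ++ b) <-> decreasing_lt m a /\ decreasing_lt m b.
Proof.
move=> ab; split=> [H|[Ha Hb] s /subseq_catP[s1 [s2 [-> u v]]]].
  by split; apply: decreasing_lt_subseq H;
    [exact: prefix_subseq|exact: suffix_subseq].
case/sorted_gtn_cat=> o1 o2 /allrelP o.
case: s1 u o1 o => [|x s1] u o1 o; first exact: Hb.
case: s2 v o2 o => [|y s2] v o2 o; first by rewrite cats0; exact: Ha.
have := o x y (mem_head _ _) (mem_head _ _).
have := ab x y (mem_subseq u (mem_head _ _)) (mem_subseq v (mem_head _ _)).
rewrite /=; lia.
Qed.

Lemma map_S_addn w : map S w = map (addn 1) w.
Proof. exact: eq_map. Qed.

(** The bound [m + 2] leaves room for the one-letter subsequence formed by the
    fixed point. *)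
Lemma decreasing_lt_fixed m w :
  decreasing_lt m.+2 (0%N :: map S w) <-> decreasing_lt m.+2 w.
Proof.
rewrite -cat1s decreasing_lt_cat; last first.
  by move=> x y; rewrite inE => /eqP -> /mapP[z _ ->].
rewrite map_S_addn decreasing_lt_map_add; split=> [[]//|H]; split=> //.
by move=> s /size_subseq /= ? _; lia.
Qed.

(** Under an arc the bound drops by two: any decreasing subsequence of [q] is
    extended by the two ends of the arc, the first letter being the largest and
    the last one the smallest of the block. *)
Lemma decreasing_lt_arc m q r : all (gtn (size q)) q ->
  decreasing_lt m.+2 (arc q r) <-> decreasing_lt m q /\ decreasing_lt m.+2 r.
Proof.
move=> /allP qlt; rewrite /arc decreasing_lt_cat; last first.
  move=> x y hx /mapP[z _ ->]; have : (x < (size q).+2)%N; last lia.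
  move: hx; rewrite inE mem_cat.
  move=> /or3P[/eqP->|/mapP[u /qlt /= hu ->]|]; [lia..|].
  by rewrite inE => /eqP->.
rewrite decreasing_lt_map_add.
suff E : decreasing_lt m.+2 ((size q).+1 :: map S q ++ [:: 0%N]) <->
  decreasing_lt m q by rewrite E.
rewrite map_S_addn; split=> H s.
- move=> sub so.
  have := H ((size q).+1 :: map (addn 1) s ++ [:: 0%N]).
  rewrite -[_ :: _ ++ _]cat1s -[in X in subseq _ X]cat1s.
  rewrite cat_subseq //; last by rewrite cat_subseq // map_subseq.
  rewrite !size_cat size_map /= => /(_ isT); rewrite addn1 => Hs; apply: Hs.
  rewrite (path_sortedE gtn_trans) all_cat.
  apply/andP; split.
    rewrite /= andbT; apply/allP => x /mapP[y /(mem_subseq sub) /qlt /= hy ->].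
    by lia.
  rewrite !(sorted_pairwise gtn_trans) pairwise_cat -!(sorted_pairwise gtn_trans).
  rewrite sorted_gtn_map_add so andbT; apply/allrelP => x y.
  by move=> /mapP[z _ ->]; rewrite inE => /eqP->.
  (* [s1] and [s4] come from the two ends of the arc: at most one letter each. *)
- rewrite -cat1s => /subseq_catP[s1 [s2 [-> h1]]].
  case/subseq_catP=> s3 [s4 [-> h3 h4]].
  case/sorted_gtn_cat=> _ /sorted_gtn_cat[o3 _ _] _.
  have := (decreasing_lt_map_add m 1 q).2 H s3 h3 o3.
  move: (size_subseq h1) (size_subseq h4); rewrite !size_cat /=; lia.
Qed.

(** * From pattern-avoiding permutations to words *)

Definition perm_word (n : nat) (p : 'S_n) : seq nat :=
  [seq val (p i) | i <- enum 'I_n].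

Lemma size_perm_word n (p : 'S_n) : size (perm_word p) = n.
Proof. by rewrite size_map size_enum_ord. Qed.

Lemma nth_perm_word n (p : 'S_n) (i : 'I_n) : nth 0%N (perm_word p) i = p i.
Proof.
by rewrite (nth_map i) ?nth_ord_enum // size_enum_ord.
Qed.

Lemma perm_word_inj n : injective (@perm_word n).
Proof.
move=> p q e; apply/permP => i; apply: val_inj => /=.
by rewrite -!nth_perm_word e.
Qed.

Lemma noncrossing_perm_wordP n (p : 'S_n) :
  noncrossing_word (perm_word p) <->
  (forall i, p (p i) = i) /\
  (forall i j : 'I_n, (i < j < p i)%N -> (p j < p i)%N).
Proof.
rewrite /noncrossing_word size_perm_word; split=> [H|[inv nc] i hi].
  split=> [i|i j hij]; have [_ h2 h3] := H i (ltn_ord i).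
    by apply: val_inj; move: h2; rewrite !nth_perm_word.
  by have := h3 j; rewrite !nth_perm_word; apply.
have {}hi : (i < n)%N by lia.
have [o ->] : exists o : 'I_n, i = o by exists (Ordinal hi).
rewrite !nth_perm_word inv; split=> [||j hj] //; first by rewrite ltn_ord.
have jn : (j < n)%N by have := ltn_ord (p o); lia.
have := nc o (Ordinal jn) hj.
by rewrite -(nth_perm_word p (Ordinal jn)).
Qed.

Lemma contains_3412P n (p : 'S_n) :
  reflect (exists a b c d : 'I_n, [/\ (a < b)%N, (b < c)%N & (c < d)%N] /\
             [/\ (p c < p d)%N, (p d < p a)%N & (p a < p b)%N])
          (contains [:: 3; 4; 1; 2]%N p).
Proof.
apply: (iffP existsP) => [[f /andP[/'forall_forallP up /'forall_forallP iso]]|].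
  pose o k (h : (k < 4)%N) := f (Ordinal h : 'I_(size [:: 3; 4; 1; 2]%N)).
  exists (o 0%N isT), (o 1%N isT), (o 2%N isT), (o 3%N isT); split; split;
  by [exact: implyP (up _ _) _ | rewrite -(eqP (iso _ _))].
move=> [a [b [c [d [[ab bc cd] [v1 v2 v3]]]]]].
exists [ffun i : 'I_4 => nth a [:: a; b; c; d] i].
apply/andP; split; apply/'forall_forallP.
  move=> [[|[|[|[|i]]]] hi] [[|[|[|[|j]]]] hj] //; rewrite !ffunE /=; lia.
move=> [[|[|[|[|i]]]] hi] [[|[|[|[|j]]]] hj] //; rewrite !ffunE /=; lia.
Qed.

(** A crossing [i < j < p i < p j] is an occurrence of 3412 at these four
    positions.  Conversely, given an occurrence at [a < b < c < d]: if [p d < c]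
    then [p c < p d < c < d] is a crossing, and otherwise
    [b < c < p d < p a], so [a < b < p a < p b] is one. *)
Lemma avoids_3412_noncrossing n (p : 'S_n) : (forall i, p (p i) = i) ->
  avoids [:: 3; 4; 1; 2]%N p <->
  (forall i j : 'I_n, (i < j < p i)%N -> (p j < p i)%N).
Proof.
move=> inv; rewrite /avoids; split=> [/contains_3412P av i j hij|nc].
  rewrite ltnNge; apply/negP => hle; apply: av.
  have ne : p i <> p j by move=> /perm_inj e; move: hij; rewrite e ltnn.
  have lt : (p i < p j)%N.
    by rewrite ltn_neqAle hle andbT; apply/eqP => /val_inj.
  by exists i, j, (p i), (p j); rewrite !inv; split; split=> //; lia.
apply/contains_3412P => -[a [b [c [d [[ab bc cd] [v1 v2 v3]]]]]].
have h1 := nc (p c) (p d); have h2 := nc a b; rewrite !inv in h1.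
(* The boundary case [p d = c] would give [p c = d > p d]. *)
have ne : p d <> c by move=> e; move: v1; rewrite -e inv; lia.
have {}ne : val (p d) <> val c by move=> /val_inj.
rewrite /= in ne; lia.
Qed.

Lemma sub_sorted_subseq (T : eqType) (r : rel T) (s w : seq T) :
  transitive r -> irreflexive r -> sorted r s -> sorted r w ->
  {subset s <= w} -> subseq s w.
Proof.
move=> tr irr ss sw sub.
have -> : s = [seq x <- w | x \in s].
  apply: (irr_sorted_eq tr irr) => // [|x]; first exact: sorted_filter.
  by rewrite mem_filter andb_idr // => /sub.
exact: filter_subseq.
Qed.

Definition ord_lt n := [rel i j : 'I_n | (i < j)%N].

Lemma sorted_enum_ord n : sorted (@ord_lt n) (enum 'I_n).
Proof. by have := iota_ltn_sorted 0 n; rewrite -val_enum_ord sorted_map. Qed.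

Lemma ord_lt_trans n : transitive (@ord_lt n).
Proof. by move=> ? ? ?; exact: ltn_trans. Qed.

Lemma nth_decreasing_pattern m i : (i < m)%N ->
  nth 0%N (decreasing_pattern m) i = (m - i)%N.
Proof.
move=> im; rewrite /decreasing_pattern nth_rev size_iota // nth_iota; lia.
Qed.

Lemma size_decreasing_pattern m : size (decreasing_pattern m) = m.
Proof. by rewrite size_rev size_iota. Qed.

(** Occurrences of the pattern are position-increasing maps ['I_m -> 'I_n],
    whereas subsequences are masks of the word; both amount to sublists of
    [enum 'I_n]. *)
Lemma avoids_decreasingP n (p : 'S_n) m :
  avoids (decreasing_pattern m) p <-> decreasing_lt m (perm_word p).
Proof.
rewrite /avoids /contains size_decreasing_pattern; split=> [/existsP H s|H].
- case/subseqP=> k sk -> so; rewrite ltnNge; apply/negP => ms; apply: H.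
  move: so ms; rewrite /perm_word -map_mask; set t := mask k _ => so.
  rewrite size_map => ms.
  have n_gt0 (i : 'I_m) : (0 < n)%N.
    have : (0 < size t)%N by have := ltn_ord i; lia.
    by case: (t) => // o _ _; have := ltn_ord o; lia.
  have tlt (i j : 'I_m) x0 : (i < j)%N -> (nth x0 t i < nth x0 t j)%N.
    have st : sorted (@ord_lt n) t.
      by apply: sorted_mask (sorted_enum_ord n); exact: ord_lt_trans.
    have := sorted_ltn_nth (@ord_lt_trans n) x0 st; apply; rewrite inE.
      by apply: leq_trans ms.
    by apply: leq_trans ms.
  have plt (i j : 'I_m) x0 : (i < j)%N -> (p (nth x0 t j) < p (nth x0 t i))%N.
    have it : (i < size t)%N by apply: leq_trans ms.
    have jt : (j < size t)%N by apply: leq_trans ms.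
    move=> ij; have := sorted_ltn_nth gtn_trans 0%N so; rewrite !size_map.
    by move=> /(_ i j it jt ij); rewrite !(nth_map x0).
  (* An index in ['I_m] makes ['I_n] nonempty, which supplies the default. *)
  exists [ffun i : 'I_m => nth (Ordinal (n_gt0 i)) t i].
  apply/andP; split; apply/'forall_forallP => i j; rewrite !ffunE;
    rewrite (bool_irrelevance (n_gt0 j) (n_gt0 i)).
    by apply/implyP; exact: tlt.
  rewrite !nth_decreasing_pattern //; apply/eqP.
  have jm := ltn_ord j; have im := ltn_ord i.
  case: (ltngtP i j) => [ij|ji|/val_inj ->]; last by rewrite !ltnn.
    have v := plt i j (Ordinal (n_gt0 i)) ij.
    by rewrite [RHS]ltnNge (ltnW v); lia.
  by rewrite plt //; lia.
- apply/existsP => -[f /andP[/'forall_forallP up /'forall_forallP iso]].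
  have := H [seq val (p (f i)) | i <- enum 'I_m].
  rewrite size_map size_enum_ord => Hf.
  have : (m < m)%N; last by rewrite ltnn.
  apply: Hf.
    rewrite (_ : map _ _ = map (fun i => val (p i)) (map f (enum 'I_m))).
      apply: map_subseq; apply: (sub_sorted_subseq (@ord_lt_trans n)).
      + by move=> i; exact: ltnn.
      + rewrite sorted_map; apply: sub_sorted (sorted_enum_ord m) => i j.
        exact: implyP (up i j).
      + exact: sorted_enum_ord.
      + by move=> i _; rewrite mem_enum.
    by rewrite -[RHS]map_comp.
  rewrite sorted_map; apply: sub_sorted (sorted_enum_ord m) => i j /= ij.
  rewrite -(eqP (iso j i)) !nth_decreasing_pattern //.
  by have := ltn_ord j; lia.
Qed.

(** * The recurrence for the numbers of avoiders *)

Definition avoiding_word (m n : nat) (w : seq nat) : Prop :=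
  [/\ size w = n, noncrossing_word w & decreasing_lt m w].

(** A duplicate-free list, so that cardinalities become sizes and bijections
    become equalities of lists up to permutation. *)
Definition avoiding_words (m n : nat) : seq (seq nat) :=
  [seq perm_word p | p <-
    enum (involutions_avoiding n [:: 3; 4; 1; 2]%N (decreasing_pattern m))].

Lemma avoiding_words_uniq m n : uniq (avoiding_words m n).
Proof. by rewrite map_inj_uniq ?enum_uniq //; exact: perm_word_inj. Qed.

Lemma word_perm n w : size w = n -> noncrossing_word w ->
  exists p : 'S_n, perm_word p = w.
Proof.
move=> sw; rewrite /noncrossing_word sw => H.
have lt (i : 'I_n) : (nth 0%N w i < n)%N by have [] := H i (ltn_ord i).
pose f (i : 'I_n) := Ordinal (lt i).
have fK : cancel f f.
  by move=> i; apply: val_inj; have [] := H i (ltn_ord i).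
exists (perm (can_inj fK)); apply: (@eq_from_nth _ 0%N).
  by rewrite size_perm_word.
rewrite size_perm_word => i hi.
by rewrite (nth_perm_word _ (Ordinal hi)) permE.
Qed.

Lemma mem_avoiding_words m n w :
  w \in avoiding_words m n <-> avoiding_word m n w.
Proof.
have E (p : 'S_n) : p \in involutions_avoiding n [:: 3; 4; 1; 2]%N
    (decreasing_pattern m) <-> avoiding_word m n (perm_word p).
  rewrite inE; split.
    case/andP=> /andP[/forallP inv av] /avoids_decreasingP dec.
    have {}inv i : p (p i) = i by exact/eqP.
    split=> //; first exact: size_perm_word.
    by apply/noncrossing_perm_wordP; split=> //; exact/avoids_3412_noncrossing.
  case=> _ /noncrossing_perm_wordP[inv nc] /avoids_decreasingP ->.
  rewrite andbT; apply/andP; split; first by apply/forallP => i; rewrite inv.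
  exact/avoids_3412_noncrossing.
split=> [/mapP[p]|gw]; first by rewrite mem_enum => /E ? ->.
have [sw nw _] := gw; have [p pw] := word_perm sw nw.
by apply/mapP; exists p; rewrite ?mem_enum //; apply/E; rewrite pw.
Qed.

Definition avoider_count (m n : nat) : nat :=
  #|involutions_avoiding n [:: 3; 4; 1; 2]%N (decreasing_pattern m)|.

Lemma size_avoiding_words m n : size (avoiding_words m n) = avoider_count m n.
Proof. by rewrite size_map -cardE. Qed.

Lemma avoider_count0 n : avoider_count 0 n = 0%N.
Proof.
rewrite -size_avoiding_words; case E : (avoiding_words 0 n) => [//|w l].
have /mem_avoiding_words[_ _ H] : w \in avoiding_words 0 n by rewrite E mem_head.
by have := H [::] (sub0seq _) isT.
Qed.

Lemma avoider_countS0 m : avoider_count m.+1 0 = 1%N.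
Proof.
rewrite -size_avoiding_words; apply/(@perm_size _ _ [:: [::]])/uniq_perm => //.
  exact: avoiding_words_uniq.
move=> w; rewrite inE; apply/idP/eqP => [/mem_avoiding_words[/size0nil//]|->].
apply/mem_avoiding_words; split=> // s.
by rewrite subseq0 => /eqP ->.
Qed.

Lemma avoider_count1S n : avoider_count 1 n.+1 = 0%N.
Proof.
rewrite -size_avoiding_words; case E : (avoiding_words 1 n.+1) => [//|w l].
have /mem_avoiding_words[] : w \in avoiding_words 1 n.+1 by rewrite E mem_head.
case: w {E} => [//|a w] _ _ H.
by have := H [:: a]; rewrite sub1seq mem_head => /(_ isT isT).
Qed.

Lemma noncrossing_word_lt w : noncrossing_word w -> all (gtn (size w)) w.
Proof.
move=> H; apply/allP => x /(nthP 0%N)[i hi <-].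
by have [] := H i hi.
Qed.

(** The decomposition of noncrossing involutions respects the bounds on
    decreasing subsequences, with [m] instead of [m + 2] under the first arc. *)
Lemma avoiding_word_decomp m n w : avoiding_word m.+2 n.+1 w <->
  (exists2 w', avoiding_word m.+2 n w' & w = 0%N :: map S w') \/
  (exists j q r, [/\ (j < n)%N, avoiding_word m j q,
     avoiding_word m.+2 (n - j.+1) r & w = arc q r]).
Proof.
split=> [[sw nw dw]|].
  have [[w' sw' ew]|[q [r [jn sr ew]]]] := noncrossing_word_decomp sw nw.
    left; exists w' => //; subst w; split=> //.
      exact/noncrossing_word_fixed.
    exact/decreasing_lt_fixed.
  right; exists (size q), q, r; subst w.
  have [nq nr] := (noncrossing_word_arc q r).1 nw.
  by have [dq dr] := (decreasing_lt_arc _ _ (noncrossing_word_lt nq)).1 dw.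
case=> [[w' [sw' nw dw] ->]|[j [q [r [jn [sq nq dq] [sr nr dr] ->]]]]].
  split; first by rewrite /= size_map sw'.
    exact/noncrossing_word_fixed.
  exact/decreasing_lt_fixed.
split; first by rewrite size_arc; lia.
  exact/noncrossing_word_arc.
by apply/decreasing_lt_arc => //; exact: noncrossing_word_lt.
Qed.

Lemma arc_inj q r q' r' : arc q r = arc q' r' -> q = q' /\ r = r'.
Proof.
move=> e; have sq : size q = size q' by case: e.
move/eqP: e; rewrite /arc sq eqseq_cat ?/= ?size_cat ?size_map ?sq //.
rewrite eqseq_cons eqseq_cat ?size_map // => /andP[/and3P[_ /eqP e1 _] /eqP e2].
split; first exact: inj_map succn_inj _ _ e1.
exact: (inj_map (@addnI _)) e2.
Qed.

(** The list of words of length [n + 1] is rearranged according to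
    [avoiding_word_decomp]; the words [arc q r] are pairwise distinct because the
    first letter gives the size of [q].  In terms of generating functions this
    says that F_(m+2) = 1 + x F_(m+2) + x^2 F_m F_(m+2). *)
Lemma avoider_count_rec m n :
  avoider_count m.+2 n.+1 = (avoider_count m.+2 n +
    \sum_(j < n) avoider_count m j * avoider_count m.+2 (n - j.+1))%N.
Proof.
pose arcs j :=
  [seq (q, r) | q <- avoiding_words m j, r <- avoiding_words m.+2 (n - j.+1)].
pose l := [seq 0%N :: map S w | w <- avoiding_words m.+2 n] ++
  [seq arc u.1 u.2 | j <- iota 0 n, u <- arcs j].
have arcsP j u : reflect
    (avoiding_word m j u.1 /\ avoiding_word m.+2 (n - j.+1) u.2) (u \in arcs j).
  apply: (iffP allpairsP) => [[[q r] /= [qin rin ->]]|[uq ur]].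
    by split; exact/mem_avoiding_words.
  by exists u; split; [exact/mem_avoiding_words..|case: (u)].
have lP w : w \in l <-> avoiding_word m.+2 n.+1 w.
  rewrite avoiding_word_decomp mem_cat; split.
    case/orP=> [/mapP[w' /mem_avoiding_words ? ->]|]; first by left; exists w'.
    case/allpairsPdep=> j [[q r] [jn /arcsP[/= ? ?] ->]]; right.
    by exists j, q, r; split=> //; move: jn; rewrite mem_iota.
  case=> [[w' /mem_avoiding_words ? ->]|[j [q [r [jn gq gr ->]]]]].
    by rewrite map_f.
  apply/orP; right; apply/allpairsPdep; exists j, (q, r); split=> //.
    by rewrite mem_iota.
  exact/arcsP.
have lU : uniq l.
  rewrite cat_uniq; apply/and3P; split.
  - rewrite map_inj_uniq ?avoiding_words_uniq // => w w' [].
    exact: inj_map succn_inj _ _.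
  - by apply/hasPn => _ /allpairsPdep[j [u [_ _ ->]]]; apply/mapP => -[].
  - apply: allpairs_uniq_dep; first exact: iota_uniq.
      move=> j _; apply: allpairs_uniq; [exact: avoiding_words_uniq..|].
      by move=> [? ?] [? ?].
    move=> [j u] [j' u'] /allpairsPdep[k [v [_ /arcsP[[sv _ _] _] [-> ->]]]].
    case/allpairsPdep=> k' [v' [_ /arcsP[[sv' _ _] _] [-> ->]]] /=.
    case/arc_inj; rewrite -sv -sv' {sv sv'}.
    by case: v v' => [? ?] [? ?] /= -> ->.
rewrite -size_avoiding_words (@perm_size _ _ l); last first.
  apply: uniq_perm => //; first exact: avoiding_words_uniq.
  by move=> w; apply/idP/idP => [/mem_avoiding_words/lP|/lP/mem_avoiding_words].
rewrite size_cat size_map size_avoiding_words; congr addn.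
rewrite size_allpairs_dep sumnE big_map -[n in iota 0 n]subn0 big_mkord.
by apply: eq_bigr => j _; rewrite size_allpairs !size_avoiding_words.
Qed.

(** * Truncated generating functions *)

Lemma congr_modXn (R : nzRingType) (N : nat) (p q : {poly R}) :
  (forall n, (n < N)%N -> p`_n = q`_n) -> exists r, p = q + r * 'X^N.
Proof.
move=> H; exists (drop_poly N (p - q)).
have t0 : take_poly N (p - q) = 0.
  apply/polyP => i; rewrite coef_take_poly coef0 coefB.
  by case: ifP => // /H ->; rewrite subrr.
by rewrite -[drop_poly _ _ * _]add0r -t0 poly_take_drop addrC subrK.
Qed.

Definition trunc_gf (R : comNzRingType) (N : nat) (a : nat -> nat) : {poly R} :=
  \poly_(i < N) (a i)%:R.

(** The convolution recurrence says that G = 1 + x G + x^2 F G for the generating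
    functions F of [a] and G of [b]; cutting both off at order N only changes
    multiples of x^N. *)
Lemma trunc_gf_rec (R : comNzRingType) (a b : nat -> nat) (N : nat) :
  b 0%N = 1%N ->
  (forall n, b n.+1 = (b n + \sum_(j < n) a j * b (n - j.+1))%N) ->
  exists r, trunc_gf R N b * (1 - 'X - 'X ^+ 2 * trunc_gf R N a) = 1 + r * 'X^N.
Proof.
move=> b0 bS; apply: congr_modXn => n nN.
set A := trunc_gf R N a; set B := trunc_gf R N b.
have -> : B * (1 - 'X - 'X ^+ 2 * A) = B - 'X * B - 'X * ('X * (A * B)) by ring.
rewrite !coefB !coefXM coef1; case: n nN => [|n] nN /=.
  by rewrite coef_poly nN b0 !subr0.
rewrite !coef_poly nN (ltnW nN) bS natrD (addrC (b n)%:R) addrK.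
case: n nN => [|n] nN /=; first by rewrite big_ord0 subr0.
apply/eqP; rewrite subr_eq0 natr_sum coefM; apply/eqP/eq_bigr => j _.
rewrite !coef_poly natrM !ifT //.
all: by have := ltn_ord j; lia.
Qed.

(** With F_m the generating function of [a m], if F_m = Q_0/Q_1, then
    F_(m+2k) = Q_k/Q_(k+1): by induction,
    1 - x - x^2 F_(m+2k) = ((1 - x) Q_(k+1) - x^2 Q_k)/Q_(k+1)
    = Q_(k+2)/Q_(k+1), and F_(m+2k+2) is the inverse of the left-hand side. *)
Lemma trunc_gf_ladder (R : comNzRingType) (a : nat -> nat -> nat)
    (Q : nat -> {poly R}) (m N : nat) :
  (forall m, a m.+2 0%N = 1%N) ->
  (forall m n, a m.+2 n.+1 = (a m.+2 n +
    \sum_(j < n) a m j * a m.+2 (n - j.+1))%N) ->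
  (forall k, Q k.+2 = (1 - 'X) * Q k.+1 - 'X ^+ 2 * Q k) ->
  Q 1%N * trunc_gf R N (a m) = Q 0%N ->
  forall k, exists r,
    Q k.+1 * trunc_gf R N (a (m + 2 * k)%N) = Q k + r * 'X^N.
Proof.
move=> a0 aS QSS Q10; elim=> [|k [r IH]].
  by exists 0; rewrite muln0 addn0 Q10 mul0r addr0.
have -> : (m + 2 * k.+1 = (m + 2 * k).+2)%N by lia.
have [s] := trunc_gf_rec R N (a0 (m + 2 * k)%N) (aS (m + 2 * k)%N).
move: IH; set A := trunc_gf R N (a (m + 2 * k)%N); set B := trunc_gf R N _.
move=> IH Hs; exists (Q k.+1 * s + 'X ^+ 2 * r * B).
have Qk : Q k = Q k.+1 * A - r * 'X^N by rewrite IH addrK.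
rewrite QSS [in LHS]Qk.
transitivity (Q k.+1 * (B * (1 - 'X - 'X ^+ 2 * A)) + 'X ^+ 2 * r * B * 'X^N).
  by ring.
by rewrite Hs; ring.
Qed.

(** * Chebyshev polynomials at (1 - x)/(2x) *)

(** The polynomials x^(k-1) U_(k-1)((1-x)/(2x)), which obey the Chebyshev
    recurrence multiplied by a power of x.  The shift by one lets the sequence
    start with U_(-1) = 0. *)
Fixpoint scaled_chebU (R : nzRingType) (k : nat) : {poly R} :=
  match k with
  | 0 => 0
  | 1 => 1
  | (k'.+1 as k1).+1 =>
      (1 - 'X) * scaled_chebU R k1 - 'X ^+ 2 * scaled_chebU R k'
  end.

Arguments scaled_chebU : simpl never.

Lemma scaled_chebUSS (R : nzRingType) k :
  scaled_chebU R k.+2 =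
    (1 - 'X) * scaled_chebU R k.+1 - 'X ^+ 2 * scaled_chebU R k.
Proof. by []. Qed.

Lemma scaled_chebU_coef0 (R : nzRingType) k : (scaled_chebU R k.+1)`_0 = 1.
Proof.
elim: k => [|k IH]; first by rewrite coef1.
rewrite scaled_chebUSS coefB !coef0M IH coefB coef1 coefX /=.
by rewrite !mul0r !subr0 mulr1.
Qed.

Lemma chebyshevU0 (R : realType) : chebyshevU R 0%N%:Z = 1.
Proof.
apply: (is_chebyshevU_unique (@chebyshevUP R 0)) => t st.
by rewrite hornerE mul1r divff.
Qed.

Lemma chebyshevU1 (R : realType) : chebyshevU R 1%N%:Z = 'X *+ 2.
Proof.
apply: (is_chebyshevU_unique (@chebyshevUP R 1)) => t st.
by rewrite hornerMn hornerX mulr_natl sin_mulr2n -mulrnAl mulfK.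
Qed.

Lemma chebyshevUSS (R : realType) (n : nat) : chebyshevU R n.+2%:Z =
  'X *+ 2 * chebyshevU R n.+1%:Z - chebyshevU R n%:Z.
Proof.
apply: (is_chebyshevU_unique (@chebyshevUP R n.+2)) => t st.
rewrite hornerD hornerN hornerM hornerMn hornerX !chebyshevUP //.
have e1 : n.+3%:R * t = n.+2%:R * t + t :> R.
  by rewrite -(natr1 n.+2) mulrDl mul1r.
have e2 : n.+1%:R * t = n.+2%:R * t - t :> R.
  by rewrite -(natr1 n.+1) mulrDl mul1r addrK.
by rewrite e1 e2 !sinD sinN cosN; field.
Qed.

(** Stated for an arbitrary morphism to a field, of which the embedding into
    the field of fractions is the case of interest: the argument only uses the
    field axioms. *)
Lemma eval_chebyshevU (R : realType) (K : fieldType)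
    (f : {rmorphism {poly R} -> K}) (k : nat) :
  f 'X != 0 -> 2%:R != 0 :> K ->
  (map_poly (f \o polyC) (chebyshevU R (k%:Z - 1))).[
      (1 - f 'X) / (2%:R * f 'X)] =
    f (scaled_chebU R k) / f 'X ^+ k * f 'X.
Proof.
set z := f 'X; set y := _ / _ => z0 two0.
pose ev p := (map_poly (f \o polyC) p).[y].
(* Two consecutive values are needed for the three-term recurrence. *)
suff : ev (chebyshevU R (k%:Z - 1)) = f (scaled_chebU R k) / z ^+ k * z /\
   ev (chebyshevU R k%:Z) = f (scaled_chebU R k.+1) / z ^+ k.+1 * z by case.
elim: k => [|k [IH1 IH2]].
  split; first by rewrite /ev rmorph0 horner0 /scaled_chebU rmorph0 !mul0r.
  rewrite chebyshevU0 /ev rmorph1 hornerC /scaled_chebU rmorph1 expr1 mul1r.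
  by rewrite mulVf.
have -> : k.+1%:Z - 1 = k%:Z by lia.
split=> //; case: k IH1 IH2 => [|k].
  move=> _ _; rewrite chebyshevU1 scaled_chebUSS /ev rmorphMn /= map_polyX.
  rewrite hornerMn hornerX mulr1 mulr0 subr0 rmorphB rmorph1 -/z /y -mulr_natl.
  by field; rewrite z0 two0.
have -> : k.+1%:Z - 1 = k%:Z by lia.
move=> IH1 IH2; rewrite chebyshevUSS (scaled_chebUSS _ k.+1).
rewrite /ev !rmorphB !rmorphM rmorphMn /=.
rewrite map_polyX hornerD hornerN hornerM hornerMn hornerX -!/(ev _) IH1 IH2.
rewrite (rmorphB f 1) rmorph1 -/z.
rewrite /y -mulr_natl !exprS; field.
by rewrite two0 z0 expf_neq0.
Qed.

(** * The generating functions *)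

(** The coefficient of x^n in a product only involves coefficients up to n, so
    that the truncation at order n + 1 computes it.  Positive orders suffice, and
    truncation at order 0 would destroy the starting value F_1 = 1. *)
Lemma expands_to_ladder (R : realType) (Q : nat -> {poly R}) (m k : nat) :
  (forall k, Q k.+2 = (1 - 'X) * Q k.+1 - 'X ^+ 2 * Q k) ->
  (forall N, Q 1%N * trunc_gf R N.+1 (avoider_count m) = Q 0%N) ->
  (Q k.+1)`_0 != 0 ->
  expands_to (FracField.tofrac (Q k) / FracField.tofrac (Q k.+1))
    (gen_fun R (decreasing_pattern (m + 2 * k))).
Proof.
move=> QSS Q10 Q0; exists (Q k), (Q k.+1); split=> // n.
have [r Hr] := trunc_gf_ladder (fun m => avoider_countS0 m.+1) avoider_count_rec
  QSS (Q10 n) k.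
have := congr1 (fun p : {poly R} => p`_n) Hr.
rewrite coefD coefMXn ltnSn addr0 => <-; rewrite coefM.
by apply: eq_bigr => i _; rewrite coef_poly ltnS leq_subr.
Qed.

(** By [eval_chebyshevU] the values in the theorem have the form b / x^k * x; the
    next two identities clear these powers of x. *)
Lemma rescaled_sum (K : fieldType) (x b a : K) (k : nat) : x != 0 ->
  b / x ^+ k.+1 * x + a / x ^+ k * x = (b + x * a) / x ^+ k.+1 * x.
Proof. by move=> x0; rewrite exprS; field; rewrite x0 expf_neq0. Qed.

Lemma rescaled_quotient (K : fieldType) (x a b : K) (k : nat) :
  x != 0 -> b != 0 ->
  a / x ^+ k * x / (x * (b / x ^+ k.+1 * x)) = a / b.
Proof. by move=> x0 b0; rewrite exprS; field; rewrite b0 x0 expf_neq0. Qed.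

Theorem theorem6p1 (R : realType) (k : nat) (hk : (1 <= k)%N) :
  let x := fracX R in
  let U (n : int) := eval_frac (chebyshevU R n) ((1 - x) / (2%:R * x)) in
  expands_to (U (k%:Z - 1) / (x * U k%:Z))
    (gen_fun R (decreasing_pattern (2 * k)%N))
  /\
  expands_to ((U (k%:Z - 1) + U (k%:Z - 2)) / (x * (U k%:Z + U (k%:Z - 1))))
    (gen_fun R (decreasing_pattern (2 * k - 1)%N)).
Proof.
move=> x U; case: k hk => [//|k] _.
pose f := @FracField.tofrac {poly R}.
have x0 : x != 0 by rewrite tofrac_eq0 polyX_eq0.
have two0 : 2%:R != 0 :> {fraction {poly R}}.
  by rewrite -(rmorph_nat f) tofrac_eq0 -polyC_natr polyC_eq0 pnatr_eq0.
have UE j : U (j%:Z - 1) = f (scaled_chebU R j) / x ^+ j * x.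
  exact: eval_chebyshevU x0 two0.
have -> : k.+1%:Z = k.+2%:Z - 1 by lia.
have -> : k.+2%:Z - 1 - 1 = k.+1%:Z - 1 by lia.
have -> : k.+2%:Z - 1 - 2 = k%:Z - 1 by lia.
have P0 j : (scaled_chebU R j.+1)`_0 != 0 by rewrite scaled_chebU_coef0 oner_neq0.
rewrite !UE; split.
- have n0 : f (scaled_chebU R k.+2) != 0.
    rewrite tofrac_eq0; apply: contraTneq (P0 k.+1) => ->.
    by rewrite coef0 eqxx.
  rewrite (rescaled_quotient (f (scaled_chebU R k.+1)) k.+1 x0 n0).
  (* The even ladder starts at F_0 = 0: every word contains the empty pattern. *)
  apply: (@expands_to_ladder R (scaled_chebU R) 0 k.+1) => // N.
  rewrite /scaled_chebU mul1r; apply/polyP => i.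
  by rewrite coef_poly avoider_count0 coef0 if_same.
- pose Q j : {poly R} := scaled_chebU R j.+1 + 'X * scaled_chebU R j.
  have QSS j : Q j.+2 = (1 - 'X) * Q j.+1 - 'X ^+ 2 * Q j.
    by rewrite /Q !(scaled_chebUSS _ j.+1) (scaled_chebUSS _ j); ring.
  have Q0 j : (Q j)`_0 != 0 by rewrite coefD coefXM addr0.
  have n0 : f (Q k.+1) != 0.
    rewrite tofrac_eq0; apply: contraTneq (Q0 k.+1) => ->.
    by rewrite coef0 eqxx.
  have fQ j : f (Q j) = f (scaled_chebU R j.+1) + x * f (scaled_chebU R j).
    by rewrite /f rmorphD rmorphM.
  rewrite !(rescaled_sum _ _ _ x0) -!fQ (rescaled_quotient (f (Q k)) k.+1 x0 n0).
  have -> : (2 * k.+1 - 1 = 1 + 2 * k)%N by lia.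
  (* The odd ladder starts at F_1 = 1: only the empty word avoids one letter. *)
  apply: (@expands_to_ladder R Q 1 k) => // N.
  rewrite /Q scaled_chebUSS /scaled_chebU !mulr0 subr0 !mulr1 addr0 subrK mul1r.
  apply/polyP => -[|i]; rewrite coef_poly coef1 ?avoider_countS0 //.
  by rewrite avoider_count1S if_same.
Qed.
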